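(* There exists a $3$-uniform hypergraph $H_1$ which has no strongly maximal matching.
   Context: A hypergraph $H$ consists of a (possibly infinite) vertex set $V$ and a set $E$ of edges, each a subset of $V$; it is $3$-uniform if every edge has exactly $3$ vertices. A matching is a set of pairwise disjoint edges. A matching $M$ of $H$ is strongly maximal if for every matching $M'$ of $H$ we have $|M\setminus M'|\geq |M'\setminus M|$ (comparison of cardinalities). *)

(* Defs.v *)
From mathcomp Require Import all_boot.
From mathcomp Require Import boolp classical_sets functions cardinality.

Set Implicit Arguments.
Unset Strict Implicit.
Unset Printing Implicit Defensive.

Local Open Scope classical_set_scope.
Local Open Scope card_scope.

Record hypergraph := Hypergraph {
  vertex : Type;
  edges : set (set vertex)
}.

Definition uniform (k : nat) (H : hypergraph) : Prop :=
  forall e : set (vertex H), edges e -> e #= `I_k.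

Definition matching (H : hypergraph) (M : set (set (vertex H))) : Prop :=
  M `<=` @edges H /\ trivIset M id.

Definition strongly_maximal (H : hypergraph) (M : set (set (vertex H))) : Prop :=
  matching M /\
  forall M' : set (set (vertex H)), matching M' -> M' `\` M #<= M `\` M'.

(* Main.v *)
(** By cardinal arithmetic only finite exchanges matter: it suffices that every
matching can trade finitely many edges for strictly more.  The model is the
hypergraph on [nat] whose edges are the finite sets of cardinality one more
than their minimum.  A finite matching leaves room for one more edge.  In an
infinite matching, dissolving an edge with minimum [k >= 3] and an edge with
huge minimum [m] frees three numbers from the former, none of them the minimum
of an edge, and enough larger numbers from the latter to build three edges.

To reach uniformity 3, the large edge with minimum [n] is replaced by a path
[A_0 B_0 A_1 ... B_(n-1) A_n] of triples (gadget [n]), consecutive ones sharing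
a vertex, where [A_0] also contains the number [n], each other [A_i] contains
some number above [n], and [B_i] contains a private vertex.  Gadget [n]
contributes [n + 1] edges to a matching exactly when all the [A_i] are used;
otherwise it contributes at most [n] edges, a number also reached by the
[B_i], which occupy no number. *)
Require Import Defs.
From mathcomp Require Import all_boot.
From mathcomp Require Import boolp classical_sets functions cardinality.
From mathcomp Require Import zify.

Set Implicit Arguments.
Unset Strict Implicit.
Unset Printing Implicit Defensive.

Local Open Scope classical_set_scope.
Local Open Scope card_scope.

(** * Finite exchanges between possibly infinite sets *)

Lemma card_seq_le (I : eqType) (A : set I) (s : seq I) :
  A `<=` [set` s] -> A #<= `I_(size s).
Proof.
case: s => [|x0 s] As.
  by have -> : A = set0; [rewrite -subset0 => x /As|exact: card_ge0].
have /card_le_trans : A #<= nth x0 (x0 :: s) @` `I_(size (x0 :: s)).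
  apply: subset_card_le => x /As /= xs.
  by exists (index x (x0 :: s)); [rewrite /mkset index_mem|rewrite nth_index].
by apply; exact: card_image_le.
Qed.

Lemma card_uniq_seq_ge (I : eqType) (A : set I) (s : seq I) :
  uniq s -> [set` s] `<=` A -> `I_(size s) #<= A.
Proof.
case: s => [|x0 s] us sA; first by rewrite II0.
have inj : {in `I_(size (x0 :: s)) &, injective (nth x0 (x0 :: s))}.
  move=> i j; rewrite !inE /= => il jl /eqP.
  by rewrite nth_uniq // => /eqP.
rewrite -(card_le_eql (inj_card_eq inj)); apply: subset_card_le => x [i il <-].
by apply: sA; rewrite /= mem_nth.
Qed.

(** The entries of [s] in [A] all occur among the entries of [r] in [s]. Discarding both leaves a
    lower bound for [B] minus [A] that still exceeds a finite upper bound for [A] minus [B]. *)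
Lemma finite_exchange (I : eqType) (A B : set I) (r s : seq I) :
  uniq s -> [set` s] `<=` B -> A `\` B `<=` [set` r] ->
  A `&` [set` s] `<=` [set` r] -> size r < size s ->
  ~ (B `\` A #<= A `\` B).
Proof.
move=> us sB ABr Asr ltrs BA.
pose s1 := [seq x <- s | x \notin A]; pose r1 := [seq x <- r | x \notin s].
pose s2 := [seq x <- s | x \in A]; pose r2 := [seq x <- r | x \in s].
have s1B : `I_(size s1) #<= B `\` A.
  apply: card_uniq_seq_ge; first exact: filter_uniq.
  move=> x /=; rewrite mem_filter => /andP[xA xs].
  by split; [exact: sB|move=> /mem_set; rewrite (negPf xA)].
have r1A : A `\` B #<= `I_(size r1).
  apply: card_seq_le => x [Ax Bx] /=; rewrite mem_filter ABr //= andbT.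
  by apply/negP => /sB.
have := card_le_trans s1B (card_le_trans BA r1A); rewrite card_le_II.
have : size s2 <= size r2.
  apply: uniq_leq_size; first exact: filter_uniq.
  move=> x; rewrite !mem_filter => /andP[/set_mem xA xs].
  by rewrite xs /=; apply: Asr.
have sizeC (P : pred I) t :
    size [seq x <- t | P x] + size [seq x <- t | ~~ P x] = size t.
  by rewrite !size_filter; exact: count_predC.
have := sizeC (mem A) s; have := sizeC (mem s) r.
rewrite /s1 /s2 /r1 /r2 /=; lia.
Qed.

(** * The path hypergraph *)

Inductive vtx := Ground of nat | L of nat & nat | R of nat & nat
  | Dummy of nat & nat.

(* [(n, i, Some y)] encodes the triple [A_i] of gadget [n] through the number
   [y], and [(n, i, None)] encodes [B_i]. *)
Definition label := (nat * nat * option nat)%type.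

Definition gadget (l : label) : nat := l.1.1.
Arguments gadget l /.

(** [R n i] links [A_i] to [B_i], and [L n i.+1] links [B_i] to [A_(i+1)]; only [Ground] vertices
    are shared between gadgets. *)
Definition ends (l : label) : set vtx :=
  let: (n, i, o) := l in
  if o is Some y then [set R n i; L n i; Ground y]
  else [set R n i; L n i.+1; Dummy n i].

Definition valid (l : label) : bool :=
  let: (n, i, o) := l in
  if o is Some y then (i <= n) && (if i == 0 then y == n else n < y)
  else i < n.

Lemma ends_inj : injective ends.
Proof.
move=> [[n i] o] [[n' i'] o'] e.
have : ends (n, i, o) (R n i) by case: (o) => [y|]; left; left.
rewrite e => h.
have [? ?] : n = n' /\ i = i' by move: h; case: (o') => [y|] [[]|] //= [].
subst n' i'; move: e; case: o o' {h} => [y|] [y'|] // e.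
- have : ends (n, i, Some y) (Ground y) by right.
  by rewrite e => -[[]|] //= [->].
- have : ends (n, i, Some y) (Ground y) by right.
  by rewrite e => -[[]|] //.
- have : ends (n, i, Some y') (Ground y') by right.
  by rewrite -e => -[[]|] //.
Qed.

Lemma card_ends l : ends l #= `I_3.
Proof.
have three (T : Type) (a b c : T) : a <> b -> a <> c -> b <> c ->
    [set a; b; c] #= `I_3.
  move=> ab ac bc; apply/eq_cardSP; exists c; first by right.
  apply/eq_cardSP; exists b; first by split=> //; left; right.
  rewrite (_ : _ `\ b = [set a]); first exact: card_set1.
  apply/seteqP; split=> [x [[[[|]|] xc] xb]|x ->] //.
  by split => //; split => //; left; left.
by case: l => [[n i] [y|]] /=; apply: three.
Qed.

Definition path_hypergraph : hypergraph :=
  {| vertex := vtx; edges := ends @` [set l | valid l] |}.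

(** Matchings seen on labels; [ends_inj] makes the translation faithful. *)
Definition packing (A : set label) : Prop :=
  A `<=` [set l | valid l] /\ trivIset A ends.

Lemma packing_matching A :
  packing A -> matching (H := path_hypergraph) (ends @` A).
Proof.
move=> [Av At]; split; first exact: image_subset.
by move=> _ _ [l Al <-] [l' Al' <-] /(At _ _ Al Al') ->.
Qed.

Lemma matching_packing (M : set (set (vertex path_hypergraph))) :
  matching M -> exists2 A, packing A & M = ends @` A.
Proof.
move=> [Me Mt]; exists (ends @^-1` M).
  split=> [l /Me [l' vl /ends_inj <-] //|l l' Ml Ml' /(Mt _ _ Ml Ml')].
  exact: ends_inj.
apply/seteqP; split=> [e Me'|_ [l Ml <-] //].
by have [l _ el] := Me _ Me'; exists l; rewrite /preimage /mkset el.
Qed.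

(** * The contribution of one gadget *)

Definition slot_ground (A : set label) n i := xget 0 [set y | A (n, i, Some y)].

(** Testing membership makes the default 0 of [slot_ground] harmless. *)
Definition filled (A : set label) n i := (n, i, Some (slot_ground A n i)) \in A.

(* Gadget [n] is on when it contributes [n + 1] edges. *)
Definition on (A : set label) n := all (filled A n) (iota 0 n.+1).

Lemma filledP A n i y :
  packing A -> A (n, i, Some y) -> filled A n i /\ y = slot_ground A n i.
Proof.
move=> [_ At] Ay; have := xgetI 0 (P := [set y | A (n, i, Some y)]) Ay.
rewrite -/(slot_ground A n i) /= => Ag; split; first exact: mem_set.
suff [] : (n, i, Some y) = (n, i, Some (slot_ground A n i)) by [].
by apply: At => //; exists (R n i); split; left; left.
Qed.

Lemma onP A n i : on A n -> i <= n -> A (n, i, Some (slot_ground A n i)).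
Proof. by move=> /allP /(_ i); rewrite mem_iota => h /h /set_mem. Qed.

(** This bounds an independent set of a path with [2p + 1] vertices. Lengthening the path adds [b p]
    and [a p.+1], of which at most one is chosen; if all earlier [a] are chosen, then [a p] excludes
    [b p], so the excess survives only when [a p.+1] is chosen too. *)
Lemma path_count (a b : pred nat) p :
  (forall i, ~~ (a i && b i)) -> (forall i, ~~ (b i && a i.+1)) ->
  count a (iota 0 p.+1) + count b (iota 0 p) <= p + all a (iota 0 p.+1).
Proof.
move=> ab ba; elim: p => [|p IH]; first by rewrite /=; case: (a 0).
have iotaSr q : iota 0 q.+1 = iota 0 q ++ [:: q] by rewrite -addn1 iotaD.
have ap : all a (iota 0 p.+1) -> a p by rewrite iotaSr all_cat /= => /and3P[].
rewrite (iotaSr p.+1) [X in count b X]iotaSr !count_cat all_cat.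
move: (iota 0 p.+1) (ab p) (ba p) IH ap => s /=; rewrite !addn0 andbT.
by case: (all a _); case: (a p); case: (b p); case: (a p.+1) => //= *; lia.
Qed.

Definition old_labels A n : seq label :=
  [seq (n, i, Some (slot_ground A n i)) | i <- iota 0 n.+1 & filled A n i] ++
  [seq (n, i, None) | i <- iota 0 n & (n, i, None) \in A].

Definition new_labels (N : pred nat) (phi : nat -> nat -> nat) n : seq label :=
  if N n then [seq (n, i, Some (phi n i)) | i <- iota 0 n.+1]
  else [seq (n, i, None) | i <- iota 0 n].

Lemma mem_old_labels A l : packing A -> A l -> l \in old_labels A (gadget l).
Proof.
case: l => [[n i] [y|]] pA Al; rewrite mem_cat; apply/orP.
  have [fi ->] := filledP pA Al; left; apply/mapP; exists i => //.
  by rewrite mem_filter fi mem_iota; have /andP[] := pA.1 _ Al.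
right; apply/mapP; exists i => //.
by rewrite mem_filter mem_iota mem_set //=; exact: (pA.1 _ Al).
Qed.

Lemma size_old_labels A n : packing A -> size (old_labels A n) <= n + on A n.
Proof.
move=> pA; rewrite size_cat !size_map !size_filter.
apply: path_count => i; apply/negP => /andP[/set_mem Al /set_mem Al'].
  suff: (n, i, Some (slot_ground A n i)) = (n, i, None) by [].
  by apply: pA.2 => //; exists (R n i); split; left; left.
suff: (n, i, None) = (n, i.+1, Some (slot_ground A n i.+1)) by [].
by apply: pA.2 => //; exists (L n i.+1); split; left; right.
Qed.

Lemma mem_new_labels N phi n l : l \in new_labels N phi n ->
  if N n then exists2 i, i <= n & l = (n, i, Some (phi n i))
  else exists2 i, i < n & l = (n, i, None).
Proof.
rewrite /new_labels; case: (N n) => /mapP[i];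
  by rewrite mem_iota => /andP[_ ?] ->; exists i.
Qed.

Lemma gadget_new_labels N phi n l : l \in new_labels N phi n -> gadget l = n.
Proof. by move=> /mem_new_labels; case: (N n) => -[i _ ->]. Qed.

Lemma uniq_new_labels N phi n : uniq (new_labels N phi n).
Proof.
rewrite /new_labels.
by case: (N n); rewrite map_inj_uniq ?iota_uniq // => i j [].
Qed.

Lemma size_new_labels N phi n : size (new_labels N phi n) = n + N n.
Proof. by rewrite /new_labels; case: (N n); rewrite size_map size_iota; lia. Qed.

(** * Resetting finitely many gadgets *)

Definition strongly_maximal_packing (A : set label) : Prop :=
  forall B, packing B -> B `\` A #<= A `\` B.

Lemma strongly_maximal_packingP (M : set (set (vertex path_hypergraph))) :
  strongly_maximal M -> exists2 A, packing A & strongly_maximal_packing A.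
Proof.
have diff (A B : set label) : ends @` B `\` ends @` A #= B `\` A.
  rewrite (_ : _ `\` _ = ends @` (B `\` A)).
    by apply: inj_card_eq => ? ? _ _; exact: ends_inj.
  apply/seteqP; split=> [_ [[l Bl <-] nA]|_ [l [Bl Al] <-]].
    by exists l => //; split => // Al; apply: nA; exists l.
  by split=> [|[l' Al' /ends_inj ll']]; [exists l|apply: Al; rewrite -ll'].
move=> [mM smM]; have [A pA eM] := matching_packing mM; exists A => // B pB.
rewrite -(card_le_eql (diff A B)) -(card_le_eqr (diff B A)) -eM.
exact: smM (packing_matching pB).
Qed.

Lemma ends_common n i o n' i' o' v :
  n != n' -> ends (n, i, o) v -> ends (n', i', o') v ->
  exists2 y, o = Some y & o' = Some y.
Proof.
move=> nn'; case: o o' => [y|] [y'|] /= [[]|] -> [[]|] //.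
all: try by case=> e; rewrite e eqxx in nn'.
by case=> ->; exists y'.
Qed.

(* All gadgets in [K] are reset: those in [N] are turned on, [phi n i] being the
   number used by [A_i] in gadget [n], and the others keep only their [B_i]. *)
Lemma switch (A : set label) (K : seq nat) (N : pred nat)
    (phi : nat -> nat -> nat) :
  packing A -> uniq K ->
  (forall n i, n \in K -> N n -> i <= n -> valid (n, i, Some (phi n i))) ->
  (forall n i n' i', n \in K -> N n -> i <= n -> n' \in K -> N n' -> i' <= n' ->
    phi n i = phi n' i' -> n = n' /\ i = i') ->
  (forall n i m j, n \in K -> N n -> i <= n ->
    A (m, j, Some (phi n i)) -> m \in K) ->
  count (on A) K < count N K -> ~ strongly_maximal_packing A.
Proof.
move=> pA uK phiv phii phiK ltK.
pose s := flatten [seq new_labels N phi n | n <- K].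
pose r := flatten [seq old_labels A n | n <- K].
pose B : set label := [set l | l \in s \/ A l /\ gadget l \notin K].
have sP l : l \in s -> let n := gadget l in n \in K /\
    if N n then exists2 i, i <= n & l = (n, i, Some (phi n i))
    else exists2 i, i < n & l = (n, i, None).
  case/flatten_mapP => n nK ln; rewrite (gadget_new_labels ln).
  by split=> //; exact: mem_new_labels.
(* A kept edge and a new one could meet only in a number, but every gadget holding a number needed
   by a new edge is in [K]. *)
have oldnew l l' v : A l -> gadget l \notin K -> l' \in s ->
    ends l v -> ends l' v -> False.
  case: l l' => [[n i] o] [[n' i'] o'] Al nK /sP[/= n'K h] lv l'v.
  have nn' : n != n' by apply: contraNneq nK => /= ->.
  have [y ? ?] := ends_common nn' lv l'v; subst o o'.
  case: ifP h => Nn' [j jn' [? yE]] //; rewrite yE in Al.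
  by move: nK; rewrite /= (phiK _ _ _ _ n'K Nn' jn' Al).
have pB : packing B.
  split=> [l [/sP[]|[/(pA.1)//]]|l l'].
    case: l => [[n i] o] /= nK; case: ifP => Nn [j jn [-> ->]] //.
    exact: phiv.
  case=> [ls|[Al lK]] [l's|[Al' l'K]] [v [lv l'v]].
  - move: ls l's lv l'v => /sP[]; case: l l' => [[n i] o] [[n' i'] o'] /= nK h.
    move=> /sP[/= n'K h'] lv l'v.
    have [nn'|nn'] := eqVneq n n'.
      subst n'; case: ifP h h' => Nn [j jn [? ?]] [j' j'n [? ?]]; subst.
        move: lv l'v => /= [[]|] -> [[]|] // [].
        + by move=> ->.
        + by move=> ->.
        by move=> /(phii _ _ _ _ nK Nn jn nK Nn j'n)[_ ->].
      by move: lv l'v => /= [[]|] -> [[]|] // [] ->.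
    have [y ? ?] := ends_common nn' lv l'v; subst o o'.
    case: ifP h => Nn [j jn [? ey]] //; case: ifP h' => Nn' [j' j'n [? ey']] //.
    have [e _] : n = n' /\ j = j' by apply: phii => //; rewrite -ey.
    by rewrite e eqxx in nn'.
  - by case: (oldnew _ _ _ Al' l'K ls l'v lv).
  - by case: (oldnew _ _ _ Al lK l's lv l'v).
  - by apply: pA.2 => //; exists v.
move=> /(_ _ pB); apply: (@finite_exchange _ A B r s).
- rewrite /s; elim: (K) uK => //= n K' IH /andP[nK' uK'].
  rewrite cat_uniq uniq_new_labels IH // andbT /=; apply/hasPn => l.
  move=> /flatten_mapP[n' n'K' /gadget_new_labels ln']; apply/negP => /gadget_new_labels ln.
  by rewrite -ln ln' n'K' in nK'.
- by move=> l ls; left.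
- move=> l [Al Bl]; apply/flatten_mapP; exists (gadget l).
    by apply/negPn/negP => lK; apply: Bl; right.
  exact: mem_old_labels.
- move=> l [Al /sP[lK _]]; apply/flatten_mapP; exists (gadget l) => //.
  exact: mem_old_labels.
(* Gadget [n] accounts for [n] edges plus one if on, so the terms [sumn K] cancel. *)
- have sr : size r <= sumn K + count (on A) K.
    rewrite /r; elim: (K) => //= n K' IH; rewrite size_cat.
    have := size_old_labels n pA; lia.
  have ss : size s = sumn K + count N K.
    rewrite /s; elim: (K) => //= n K' IH; rewrite size_cat IH size_new_labels; lia.
  by rewrite ss (leq_ltn_trans sr) // ltn_add2l.
Qed.

(** * Improving an arbitrary packing *)

Lemma ground_owner A n i n' i' y :
  packing A -> A (n, i, Some y) -> A (n', i', Some y) -> n = n' /\ i = i'.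
Proof.
move=> pA Al Al'.
suff [-> ->] : (n, i, Some y) = (n', i', Some y) by [].
by apply: pA.2 => //; exists (Ground y); split; right.
Qed.

Lemma on_ground0 A n : packing A -> on A n -> A (n, 0, Some n).
Proof.
move=> pA /onP /(_ (leq0n n)) An.
by have /= /eqP e := pA.1 _ An; rewrite e in An.
Qed.

(** A gadget [n] beyond all numbers held by on gadgets can be fed [n, ..., 2n]: these are held only
    by off gadgets, whose reset costs nothing. *)
Lemma not_strongly_maximal_finite A b :
  packing A -> (forall n, on A n -> n < b) -> ~ strongly_maximal_packing A.
Proof.
move=> pA onb.
pose n := (b + \max_(k < b) \max_(i < k.+1) slot_ground A k i).+1.
have on_lt k j y : on A k -> A (k, j, Some y) -> y < n.
  move=> onk Ay; have [_ ->] := filledP pA Ay.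
  have /= /andP[jk _] := pA.1 _ Ay.
  rewrite ltnS; apply: leq_trans (leq_addl _ _).
  apply: leq_trans (leq_bigmax (Ordinal (onb _ onk))).
  exact: (leq_bigmax (Ordinal (jk : j < k.+1))).
(* For a free number the default is [n], which is in [K] anyway. *)
pose user y := xget n [set k | exists j, A (k, j, Some y)].
pose K := undup (n :: [seq user y | y <- iota n n.+1]).
apply: (@switch A K (pred1 n) (fun n i => n + i) pA).
- exact: undup_uniq.
- by move=> m i _ /eqP -> im /=; rewrite im /=; case: eqP => *; lia.
- by move=> m i m' i' _ /eqP -> _ _ /eqP -> _ /addnI.
- move=> m i k j _ /eqP -> im Ak; rewrite mem_undup inE; apply/orP; right.
  apply/mapP; exists (n + i); first by rewrite mem_iota; lia.
  apply/esym/xget_unique; first by exists j.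
  by move=> k' [j' Ak']; have [] := ground_owner pA Ak' Ak.
have -> : count (on A) K = 0.
  apply/eqP; rewrite -leqn0 leqNgt -has_count; apply/hasPn => k.
  have nn : ~~ on A n by apply/negP => /onb; rewrite /n; lia.
  rewrite mem_undup inE => /orP[/eqP -> //|/mapP[y]].
  rewrite mem_iota /user => /andP[ny _] ->.
  case: xgetP => // k' _ [j Ak']; apply/negP => /on_lt /(_ Ak'); lia.
by rewrite -has_count; apply/hasP; exists n => //=; rewrite mem_undup mem_head.
Qed.

(* Removing gadgets [k] and [m] releases three grounds [x] held by [k], which
   activate three new gadgets, fed by the many grounds held by [m]. *)
Lemma not_strongly_maximal_infinite A :
  packing A -> (forall b, exists2 n, b <= n & on A n) ->
  ~ strongly_maximal_packing A.
Proof.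
move=> pA onA; have [k k3 onk] := onA 3.
pose x := slot_ground A k.
have xk i : 0 < i -> i <= 3 -> A (k, i, Some (x i)) /\ k < x i.
  move=> i0 i3; have ik : i <= k by lia.
  have Ax := onP onk ik; split => //.
  by have /= := pA.1 _ Ax; rewrite ik /= eqn0Ngt i0.
have [_ x1] := xk 1 isT isT.
pose N : seq nat := [:: x 1; x 2; x 3].
have NP n : n \in N -> [/\ k < n, ~~ on A n & exists j, A (k, j, Some n)].
  suff xP i : 0 < i -> i <= 3 ->
      [/\ k < x i, ~~ on A (x i) & exists j, A (k, j, Some (x i))].
    by rewrite !inE => /or3P[] /eqP ->; exact: xP.
  move=> i0 i3; have [Ax kx] := xk i i0 i3; split=> //; last by exists i.
  (* If gadget [x i] were on, its [A_0] would hold the number [x i], already held by slot [i > 0] of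
     gadget [k]. *)
  apply/negP => /(on_ground0 pA) /(ground_owner pA Ax)[]; lia.
(* [c] exceeds every [n] in [N], so for [i <= n] the slot [i * c + n] of gadget [m] has base-[c]
   digits [i] and [n]: it determines both and lies below [c * c]. *)
pose c := (x 1 + x 2 + x 3).+1.
have Nc n : n \in N -> n < c by rewrite !inE => /or3P[] /eqP ->; rewrite /c; lia.
have [m mc onm] := onA (c * c).
have km : k < m by rewrite /c in mc; nia.
have uN : uniq N.
  rewrite (map_inj_in_uniq (s := [:: 1; 2; 3])) // => i j i3 j3 e.
  have [||Ai _] := xk i; [by move: i3; rewrite !inE; lia..|].
  have [||Aj _] := xk j; [by move: j3; rewrite !inE; lia..|].
  by rewrite e in Ai; have [] := ground_owner pA Ai Aj.
have index_le n i : n \in N -> i <= n -> i != 0 -> i * c + n <= m.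
  by move=> /Nc nc lin i0; nia.
pose phi n i := if i == 0 then n else slot_ground A m (i * c + n).
have Aphi n i : n \in N -> i <= n -> i != 0 -> A (m, i * c + n, Some (phi n i)).
  move=> nN lin i0; rewrite /phi (negPf i0).
  by apply: onP => //; exact: index_le.
have mN : m \notin N.
  by apply/negP => /NP[_]; rewrite onm.
have kN : k \notin N by apply/negP => /NP[]; rewrite ltnn.
apply: (@switch A [:: k, m & N] (mem N) phi pA).
- by rewrite /= inE negb_or kN mN andbT; apply/andP; split; [apply/eqP; lia|].
- move=> n i _ nN lin /=; rewrite lin /=.
  case: eqP => [->|/eqP i0]; first by rewrite /phi.
  have /= := pA.1 _ (Aphi _ _ nN lin i0); have [kn _ _] := NP _ nN.
  have := Nc _ nN; case: eqP; last by move=> *; nia.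
  by move=> *; lia.
- move=> n i n' i' _ nN lin _ n'N lin' e.
  have [i0|i0] := eqVneq i 0; have [i'0|i'0] := eqVneq i' 0.
  + by move: e; rewrite /phi i0 i'0.
  + have := Aphi _ _ n'N lin' i'0; rewrite -e i0 /phi /=.
    have [_ _ [j Aj]] := NP _ nN; move=> /(ground_owner pA Aj)[]; lia.
  + have := Aphi _ _ nN lin i0; rewrite e i'0 /phi /=.
    have [_ _ [j Aj]] := NP _ n'N; move=> /(ground_owner pA Aj)[]; lia.
  have := Aphi _ _ nN lin i0; rewrite e.
  move=> /(ground_owner pA)/(_ (Aphi _ _ n'N lin' i'0)).
  have := Nc _ nN; have := Nc _ n'N => n'c nc [_ eq].
  have nn' : n = n' by have := congr1 (modn^~ c) eq; rewrite !modnMDl !modn_small.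
  by split => //; subst n'; move/addIn/eqP: eq; rewrite eqn_pmul2r // => /eqP.
- move=> n i l j _ nN lin Al; rewrite !inE.
  have [i0|i0] := eqVneq i 0.
    have [_ _ [j' Aj]] := NP _ nN; move: Al; rewrite /phi i0 /=.
    by move=> /(ground_owner pA Aj)[<-]; rewrite eqxx.
  by have [-> _] := ground_owner pA Al (Aphi _ _ nN lin i0); rewrite eqxx orbT.
have N_off : count (on A) N = 0.
  by apply/eqP; rewrite -leqn0 leqNgt -has_count; apply/hasPn => n /NP[].
have N_new : count (mem N) N = 3.
  by apply/eqP; rewrite -[3]/(size N) -all_count; apply/allP.
rewrite -[[:: k, m & N]]/([:: k; m] ++ N) !count_cat N_off N_new /=.
by case: (on A k); case: (on A m); lia.
Qed.

Theorem theorem1p2 :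
  exists H1 : hypergraph,
    uniform 3 H1 /\ ~ (exists M : set (set (vertex H1)), strongly_maximal M).
Proof.
exists path_hypergraph; split=> [_ [l _ <-]|[M]]; first exact: card_ends.
move=> /strongly_maximal_packingP[A pA].
have [[b onb]|nb] := pselect (exists b, forall n, on A n -> n < b).
  exact: not_strongly_maximal_finite pA onb.
apply: not_strongly_maximal_infinite pA _ => b.
apply: contrapT => nonb; apply: nb; exists b => n onn.
by rewrite ltnNge; apply/negP => bn; apply: nonb; exists n.
Qed.
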